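(* Let $w$ be a 2D-weight. Then there exists a unique continuous linear operator $\mathfrak{K}_w:\mathcal{S}^*(M)\to\mathcal{S}^*(M)$ such that $$\widehat{\mathfrak{K}_w\Phi}(\sigma)=\vartheta_w(\sigma)\widehat{\Phi}(\sigma),\qquad \sigma\in\Gamma,\ \Phi\in\mathcal{S}^*(M).$$
   Context: Let $(\Omega,\mathcal{F},P)$ be a probability space and $M=(M_n)_{n\ge0}$ a discrete-time normal martingale on it (a centred martingale w.r.t. $\mathcal{F}_n=\sigma(M_k;0\le k\le n)$ with $\mathbb{E}[M_0^2]=1$ and $\mathbb{E}[M_n^2\mid\mathcal{F}_{n-1}]=M_{n-1}^2+1$ for $n\ge1$). Put $Z_0=M_0$, $Z_n=M_n-M_{n-1}$ ($n\ge1$). $\Gamma$ is the set of finite subsets of $\mathbb{N}=\{0,1,\dots\}$; $Z_\emptyset=1$, $Z_\sigma=\prod_{j\in\sigma}Z_j$. Assume $M$ has the chaotic representation property, i.e. $\{Z_\sigma\}_{\sigma\in\Gamma}$ is an orthonormal basis of the complex Hilbert space $\mathcal{L}^2(M)=L^2(\Omega,\sigma(M_n;n\ge0),P)$ (inner product $\langle\cdot,\cdot\rangle$ conjugate-linear in the first argument). Let $\lambda_\emptyset=1$, $\lambda_\sigma=\prod_{k\in\sigma}(k+1)$. For integers $p\ge0$, $\mathcal{S}_p(M)=\{\xi\in\mathcal{L}^2(M):\|\xi\|_p^2:=\sum_\sigma\lambda_\sigma^{2p}|\langle Z_\sigma,\xi\rangle|^2<\infty\}$ (a Hilbert space); $\mathcal{S}(M)=\bigcap_{p\ge0}\mathcal{S}_p(M)$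 with the topology of the norms $\|\cdot\|_p$ (a countably Hilbertian nuclear space); $\mathcal{S}^*(M)$ is its dual with the strong topology, $\mathcal{S}_p^*(M)$ the dual of $\mathcal{S}_p(M)$ with norm $\|\cdot\|_{-p}$, and $\mathcal{S}^*(M)=\bigcup_p\mathcal{S}_p^*(M)$, the strong topology coinciding with the inductive limit topology. The Fock transform of $\Phi\in\mathcal{S}^*(M)$ is $\widehat\Phi(\sigma)=\Phi(Z_\sigma)$, $\sigma\in\Gamma$; it determines $\Phi$, a function $F$ on $\Gamma$ is a Fock transform of some $\Phi\in\mathcal{S}^*(M)$ iff $|F(\sigma)|\le C\lambda_\sigma^p$ for some constants $C,p\ge0$, and $\|\Phi\|_{-p}^2=\sum_\sigma\lambda_\sigma^{-2p}|\widehat\Phi(\sigma)|^2$ (with $\Phi\in\mathcal{S}_p^*(M)$ iff this is finite). A 2D-weight is a nonnegative $w$ on $\mathbb{N}\times\mathbb{N}$ with $\alpha_w:=\sup_k\sum_j w(j,k)<\infty$; its spectral function is $\vartheta_w(\sigma)=\sum_j\mathbf{1}_\sigma(j)w(j,j)+\sum_{j,k}(1-\mathbf{1}_\sigma(j))\mathbf{1}_\sigma(k)w(j,k)$, where $\mathbf{1}_\sigma$ is the indicator of $\sigma$. *)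

(* Defs.v *)
From HB Require Import structures.
From mathcomp Require Import all_boot all_order all_algebra.
From mathcomp Require Import finmap.
From mathcomp Require Import all_classical all_reals all_analysis.
From mathcomp Require Import complex.
Set Implicit Arguments. Unset Strict Implicit. Unset Printing Implicit Defensive.
Import Order.TTheory GRing.Theory Num.Theory.
Local Open Scope classical_set_scope.
Local Open Scope ring_scope.
Local Open Scope complex_scope.

Definition dual (R : realType) (Omega : Type) := (Omega -> R[i]) -> R[i].

Section Setting.
Context {R : realType} {d : measure_display} {Omega : measurableType d}.
Variable (P : probability Omega R) (M : nat -> Omega -> R).

Definition cre (z : R[i]) : R := complex.Re z.
Definition cim (z : R[i]) : R := complex.Im z.

Definition cabs (z : R[i]) : R := Num.sqrt (cre z ^+ 2 + cim z ^+ 2).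

Definition Zinc (n : nat) : Omega -> R :=
  fun w => if n is m.+1 then M n w - M m w else M 0 w.

Definition Zs (s : {fset nat}) : Omega -> R :=
  fun w => \prod_(j <- s) Zinc j w.
Definition ZsC (s : {fset nat}) : Omega -> R[i] := fun w => (Zs s w)%:C.

Definition lam (s : {fset nat}) : nat := \prod_(k <- s) k.+1.

Definition Fn (n : nat) : set (set Omega) :=
  <<s \bigcup_(k in [set k | (k <= n)%N]) [set M k @^-1` B | B in [set B : set R | measurable B]] >>.
Definition FM : set (set Omega) :=
  <<s \bigcup_(k in [set: nat]) [set M k @^-1` B | B in [set B : set R | measurable B]] >>.

Definition E (f : Omega -> R) : R := Rintegral P setT f.

(** inner product <xi, eta> = E[conj(xi) eta], conjugate-linear in the first argument *)
Definition ip (xi eta : Omega -> R[i]) : R[i] :=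
  (E (fun w => cre (xi w) * cre (eta w) + cim (xi w) * cim (eta w)))
  +i* (E (fun w => cre (xi w) * cim (eta w) - cim (xi w) * cre (eta w))).

Definition FM_measurable (f : Omega -> R) : Prop :=
  forall B : set R, measurable B -> FM (f @^-1` B).
Definition L2M (xi : Omega -> R[i]) : Prop :=
  [/\ FM_measurable (fun w => cre (xi w)), FM_measurable (fun w => cim (xi w)),
      P.-integrable setT (fun w => ((cre (xi w)) ^+ 2)%:E) &
      P.-integrable setT (fun w => ((cim (xi w)) ^+ 2)%:E)].

Definition normal_martingale : Prop :=
  [/\
      (forall n, measurable_fun setT (M n)) /\
      (forall n, P.-integrable setT (fun w => ((M n w) ^+ 2)%:E)),
      (forall n, E (M n) = 0),
      (* martingale: E[M_n | F_(n-1)] = M_(n-1), via the defining property *)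
      (forall n A, Fn n A ->
         (\int[P]_(w in A) (M n.+1 w)%:E = \int[P]_(w in A) (M n w)%:E)%E),
      E (fun w => M 0 w ^+ 2) = 1 &
      (* E[M_n^2 | F_(n-1)] = M_(n-1)^2 + 1 *)
      (forall n A, Fn n A ->
         (\int[P]_(w in A) ((M n.+1 w) ^+ 2)%:E
         = \int[P]_(w in A) ((M n w) ^+ 2 + 1)%:E)%E)].

Definition CRP : Prop :=
  [/\ (forall s, L2M (ZsC s)),
      (forall s t, ip (ZsC s) (ZsC t) = (if s == t then 1 else 0)) &
      (forall xi, L2M xi -> (forall s, ip (ZsC s) xi = 0) ->
         {ae P, forall w, xi w = 0})].

Definition normsq (p : nat) (xi : Omega -> R[i]) : \bar R :=
  \esum_(s in [set: {fset nat}]) (((lam s)%:R ^+ (2 * p) * cabs (ip (ZsC s) xi) ^+ 2)%:E).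

Definition SM (xi : Omega -> R[i]) : Prop :=
  L2M xi /\ forall p, (normsq p xi < +oo)%E.

(** S*(M): continuous linear functionals on S(M) (whose topology is given by the
    norms ||.||_p).  Each functional is represented by its unique extension by 0
    outside S(M), so that equality in S*(M) is Leibniz equality. *)
Definition SMdual (Phi : dual R Omega) : Prop :=
  [/\ (forall a xi eta, SM xi -> SM eta ->
         Phi (fun w => a * xi w + eta w) = a * Phi xi + Phi eta),
      (exists (p : nat) (C : R), forall xi, SM xi ->
         (((cabs (Phi xi)) ^+ 2)%:E <= C%:E * normsq p xi)%E) &
      (forall xi, ~ SM xi -> Phi xi = 0)].

Definition SM_bounded (B : set (Omega -> R[i])) : Prop :=
  B `<=` SM /\ forall p, exists C : R, forall xi, B xi -> (normsq p xi <= C%:E)%E.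

Definition pB (B : set (Omega -> R[i])) (Phi : dual R Omega) : \bar R :=
  ereal_sup [set (cabs (Phi xi))%:E | xi in B].

Definition strong_open (U : set (dual R Omega)) : Prop :=
  U `<=` SMdual /\
  forall Phi, U Phi -> exists B (e : R), [/\ SM_bounded B, 0 < e &
    [set Psi | SMdual Psi /\ (pB B (fun xi => (Psi xi - Phi xi)%R) < e%:E)%E] `<=` U].

Definition cont_lin_op (K : dual R Omega -> dual R Omega) : Prop :=
  [/\ (forall Phi, SMdual Phi -> SMdual (K Phi)),
      (forall (a : R[i]) Phi Psi, SMdual Phi -> SMdual Psi ->
         K (fun xi => a * Phi xi + Psi xi) = (fun xi => a * K Phi xi + K Psi xi)) &
      (forall U, strong_open U -> strong_open [set Phi | SMdual Phi /\ U (K Phi)])].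

Definition fock (Phi : dual R Omega) (s : {fset nat}) : R[i] := Phi (ZsC s).

End Setting.

Definition ind (s : {fset nat}) (j : nat) {R : realType} : R := if j \in s then 1 else 0.

Definition is_2Dweight {R : realType} (w : nat -> nat -> R) : Prop :=
  (forall j k, 0 <= w j k) /\
  exists A : R, forall k, (\esum_(j in [set: nat]) (w j k)%:E <= A%:E)%E.

Definition spectral {R : realType} (w : nat -> nat -> R) (s : {fset nat}) : R :=
  fine (\esum_(j in [set: nat]) (ind s j * w j j)%:E
      + \esum_(jk in [set: nat * nat])
          ((1 - ind s jk.1) * ind s jk.2 * w jk.1 jk.2)%:E)%E.

(* Main.v *)
(* The operator is K Phi (xi) = lim_N Phi (T_N xi), where T_N truncates the chaos
   expansion of xi to the first N elements of Gamma and multiplies its sigma-th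
   coefficient by the spectral function. Since the latter is at most
   2 alpha #|sigma| <= 2 alpha lambda_sigma, T_N maps S_(p+1) to S_p with a bound
   independent of N, and a p-continuous Phi makes Phi (T_N xi) Cauchy. All
   estimates involve finite sums only, so neither the completeness of L^2 nor the
   nuclearity of S(M) enters. Uniqueness holds because the truncated expansions of
   xi converge to xi in every norm, so a functional is determined by its values on
   the Z_sigma. *)
Require Import Defs.
From HB Require Import structures.
From mathcomp Require Import all_boot all_order all_algebra.
From mathcomp Require Import finmap.
From mathcomp Require Import all_classical all_reals all_analysis.
From mathcomp Require Import complex.
From mathcomp Require Import measurable_realfun zify ring lra.
Import Order.TTheory GRing.Theory Num.Theory.
Import numFieldNormedType.Exports.
Local Open Scope classical_set_scope.
Local Open Scope ring_scope.
Local Open Scope complex_scope.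

(** * Modulus and convergence of complex numbers *)

Section ComplexNumbers.
Context {R : realType}.
Implicit Types (z x y : R[i]) (u v : nat -> R[i]).

Lemma cabs_ge0 z : 0 <= cabs z.
Proof. exact: sqrtr_ge0. Qed.

Lemma cabs_sqr z : cabs z ^+ 2 = cre z ^+ 2 + cim z ^+ 2.
Proof. by rewrite sqr_sqrtr// addr_ge0// sqr_ge0. Qed.

Lemma cabs_norm z : (cabs z)%:C = `|z|.
Proof. by rewrite normc_def. Qed.

Lemma cabsM x y : cabs (x * y) = cabs x * cabs y.
Proof. by apply: complexI; rewrite rmorphM/= !cabs_norm normrM. Qed.

Lemma cabsN x : cabs (- x) = cabs x.
Proof. by apply: complexI; rewrite !cabs_norm normrN. Qed.

Lemma cabs_triangle x y : cabs (x + y) <= cabs x + cabs y.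
Proof. by rewrite -lecR rmorphD/= !cabs_norm ler_normD. Qed.

Lemma cabs0 : cabs 0 = 0 :> R.
Proof. by apply: complexI; rewrite cabs_norm normr0. Qed.

Lemma cabs_real (r : R) : cabs r%:C = `|r|.
Proof. by rewrite /cabs /cre /cim /= expr0n /= addr0 sqrtr_sqr. Qed.

Lemma cabs_sqrD x y : cabs (x + y) ^+ 2 <= 2 * (cabs x ^+ 2 + cabs y ^+ 2).
Proof.
apply: (@le_trans _ _ ((cabs x + cabs y) ^+ 2)).
  by rewrite ler_pXn2r ?nnegrE ?addr_ge0 ?cabs_ge0 ?cabs_triangle.
have := sqr_ge0 (cabs x - cabs y); nra.
Qed.

Lemma creD x y : cre (x + y) = cre x + cre y.
Proof. by case: x y => [a b] [a' b']. Qed.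

Lemma cimD x y : cim (x + y) = cim x + cim y.
Proof. by case: x y => [a b] [a' b']. Qed.

Lemma creB x y : cre (x - y) = cre x - cre y.
Proof. by case: x y => [a b] [a' b']. Qed.

Lemma cimB x y : cim (x - y) = cim x - cim y.
Proof. by case: x y => [a b] [a' b']. Qed.

Lemma creM x y : cre (x * y) = cre x * cre y - cim x * cim y.
Proof. by case: x y => [a b] [a' b']. Qed.

Lemma cimM x y : cim (x * y) = cre x * cim y + cim x * cre y.
Proof. by case: x y => [a b] [a' b']. Qed.

Lemma cplx_eq x y : cre x = cre y -> cim x = cim y -> x = y.
Proof. by case: x y => [a b] [a' b'] /= -> ->. Qed.

Lemma cre_le z : `|cre z| <= cabs z.
Proof. by rewrite -sqrtr_sqr ler_wsqrtr// lerDl sqr_ge0. Qed.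

Lemma cim_le z : `|cim z| <= cabs z.
Proof. by rewrite -sqrtr_sqr ler_wsqrtr// lerDr sqr_ge0. Qed.

(** Stated on real and imaginary parts, so that limit laws and the completeness of [R] apply to each
    coordinate. *)
Definition cplx_cvg u z : Prop :=
  ((cre (u n)) @[n --> \oo] --> cre z) /\ ((cim (u n)) @[n --> \oo] --> cim z).

Lemma cplx_cvg_unique u x y : cplx_cvg u x -> cplx_cvg u y -> x = y.
Proof.
move=> [rx ix] [ry iy]; apply: cplx_eq.
  by rewrite -(cvg_lim _ rx)// -(cvg_lim _ ry).
by rewrite -(cvg_lim _ ix)// -(cvg_lim _ iy).
Qed.

Lemma cplx_cvgD u v x y :
  cplx_cvg u x -> cplx_cvg v y -> cplx_cvg (fun n => u n + v n) (x + y).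
Proof.
move=> [rx ix] [ry iy]; split.
  by under eq_fun do rewrite creD; rewrite creD; exact: cvgD.
by under eq_fun do rewrite cimD; rewrite cimD; exact: cvgD.
Qed.

Lemma cplx_cvgM a u x : cplx_cvg u x -> cplx_cvg (fun n => a * u n) (a * x).
Proof.
move=> [rx ix]; split.
  under eq_fun do rewrite creM.
  by rewrite creM; apply: cvgB; apply: cvgMr.
under eq_fun do rewrite cimM.
by rewrite cimM; apply: cvgD; apply: cvgMr.
Qed.

Lemma cplx_cvg_near u v z :
  (\forall n \near \oo, u n = v n) -> cplx_cvg u z -> cplx_cvg v z.
Proof.
move=> uv [ru iu]; split.
  by apply: cvg_trans ru; apply: near_eq_cvg; near=> n; rewrite (near uv n).
by apply: cvg_trans iu; apply: near_eq_cvg; near=> n; rewrite (near uv n).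
Unshelve. all: by end_near. Qed.

Lemma cplx_cvg_cst z : cplx_cvg (fun=> z) z.
Proof. by split; exact: cvg_cst. Qed.

Lemma cplx_cvg_sqr u z :
  cplx_cvg u z -> (cabs (u n) ^+ 2) @[n --> \oo] --> cabs z ^+ 2.
Proof.
move=> [ru iu]; under eq_fun do rewrite cabs_sqr.
by rewrite cabs_sqr; apply: cvgD; apply: cvgM.
Qed.

Lemma cplx_cvg_cabs_sqr_le u z (b : R) :
  cplx_cvg u z -> (forall n, cabs (u n) ^+ 2 <= b) -> cabs z ^+ 2 <= b.
Proof.
move=> /cplx_cvg_sqr uz ub; rewrite -(cvg_lim _ uz)//.
by apply: limr_le; [apply/cvg_ex; eexists; exact: uz|exact: nearW].
Qed.

Lemma cplx_cvg_cabs_le u z (b : R) :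
  0 <= b -> cplx_cvg u z -> (forall n, cabs (u n) <= b) -> cabs z <= b.
Proof.
move=> b0 uz ub; rewrite -(@ler_pXn2r _ 2) ?nnegrE ?cabs_ge0//.
apply: cplx_cvg_cabs_sqr_le uz _ => n.
by rewrite ler_pXn2r ?nnegrE ?cabs_ge0.
Qed.

(** Both coordinates are dominated by the modulus. The hypothesis is squared because continuity of
    functionals is expressed through squared norms. *)
Lemma cplx_cvg_sqr0 u z :
  (cabs (u n - z) ^+ 2) @[n --> \oo] --> (0 : R) -> cplx_cvg u z.
Proof.
move=> h; have bnd (g : R[i] -> R) : (forall x, `|g x| <= cabs x) ->
    g (u n - z) @[n --> \oo] --> (0 : R).
  move=> gle; apply/cvgrPdist_lt => e e0.
  have /cvgrPdist_lt/(_ _ (exprn_gt0 2 e0)) := h.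
  apply: filterS => n; rewrite !sub0r !normrN (ger0_norm (sqr_ge0 _)) => lt.
  apply: le_lt_trans (gle _) _.
  by rewrite -(@ltr_pXn2r _ 2) ?nnegrE ?cabs_ge0// ltW.
split; apply/subr_cvg0.
  by move: (bnd _ cre_le); under eq_fun do rewrite creB.
by move: (bnd _ cim_le); under eq_fun do rewrite cimB.
Qed.

(** Meant for [a] a multiple of the partial sums of a squared norm: their convergence makes both
    coordinates of [u] Cauchy. *)
Lemma cplx_cauchy_cvg u (a : nat -> R) : cvgn a ->
  (forall m n, (m <= n)%N -> cabs (u n - u m) ^+ 2 <= a n - a m) ->
  exists z, cplx_cvg u z.
Proof.
move=> ca hu.
have bnd (g : R[i] -> R) : (forall x, `|g x| <= cabs x) ->
    (forall x y, g (x - y) = g x - g y) -> cvgn (fun n => g (u n)).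
  move=> gle gB; apply: cauchy_cvg; apply/cauchy_exP.
  move=> e e0.
  (* If [a n] and [a N] are both within [e ^+ 2 / 2] of the limit, they differ by less than
     [e ^+ 2]. *)
  have e20 : 0 < e ^+ 2 / 2 by rewrite divr_gt0// exprn_gt0.
  have /cvgrPdist_lt/(_ _ e20)[N _ hN] : (a n @[n --> \oo] --> limn a) by [].
  exists (g (u N)); exists N => // n /= Nn.
  rewrite -ball_normE /ball_ /= distrC -gB; apply: le_lt_trans (gle _) _.
  rewrite -(@ltr_pXn2r _ 2) ?nnegrE ?cabs_ge0//; last exact: ltW.
  apply: le_lt_trans (hu _ _ Nn) _.
  move: (hN _ Nn) (hN _ (leqnn N)) => /=.
  by rewrite !ltr_norml; lra.
have cr := bnd _ cre_le creB.
have ci := bnd _ cim_le cimB.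
by exists (limn (fun n => cre (u n)) +i* limn (fun n => cim (u n))); split.
Qed.

End ComplexNumbers.

(** * Square-integrable functions and linearity of the inner product *)

Section RealSquareIntegrable.
Context {R : realType} {d : measure_display} {Omega : measurableType d}.
Variables (P : probability Omega R) (M : nat -> Omega -> R).
Hypothesis measM : forall n, measurable_fun setT (M n).

Definition real_L2 (u : Omega -> R) : Prop :=
  FM_measurable M u /\ P.-integrable setT (fun w => (u w ^+ 2)%:E).

Let FM_generators : set (set Omega) :=
  \bigcup_(k in [set: nat]) [set M k @^-1` B | B in [set B : set R | measurable B]].

(** Gives access to the closure properties of measurable functions for the sigma-algebra generated
    by [M]. *)
Lemma FM_measurableP (u : Omega -> R) : FM_measurable M u <->
  measurable_fun [set: g_sigma_algebraType FM_generators] u.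
Proof.
split=> [mu _ B mB|mu B mB]; first by rewrite setTI; exact: mu.
by have := mu measurableT B mB; rewrite setTI.
Qed.

Lemma FM_sub (A : set Omega) : FM M A -> measurable A.
Proof.
apply: smallest_sub; first exact: sigma_algebra_measurable.
move=> _ [k _ [B mB <-]].
by rewrite -[X in measurable X]setTI; exact: measM.
Qed.

Lemma FM_measurable_fun (u : Omega -> R) :
  FM_measurable M u -> measurable_fun setT u.
Proof. by move=> mu _ B mB; rewrite setTI; apply: FM_sub; exact: mu. Qed.

Lemma real_L2_lin (a b : R) u v : real_L2 u -> real_L2 v ->
  real_L2 (fun w => a * u w + b * v w).
Proof.
move=> [mu iu] [mv iv]; split.
  apply/FM_measurableP; apply: measurable_funD; apply: measurable_funM;
    solve [exact: measurable_cst | exact/FM_measurableP].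
have mu' := FM_measurable_fun _ mu; have mv' := FM_measurable_fun _ mv.
(* Domination by [(x + y)^2 <= 2 x^2 + 2 y^2], where the gap is [(x - y)^2]. *)
apply: (le_integrable measurableT (f := fun w => ((a * u w + b * v w) ^+ 2)%:E)
   (g := fun w => (2 * a ^+ 2)%:E * (u w ^+ 2)%:E + (2 * b ^+ 2)%:E * (v w ^+ 2)%:E)%E).
- apply/measurable_EFinP; apply: measurable_funX; apply: measurable_funD;
  by apply: measurable_funM => //; exact: measurable_cst.
- move=> w _; rewrite -!EFinM -EFinD !abse_EFin lee_fin [leLHS]ger0_norm ?sqr_ge0//.
  have nn x y : 0 <= 2 * x ^+ 2 * y ^+ 2 :> R.
    by apply: mulr_ge0; [apply: mulr_ge0|]; rewrite ?sqr_ge0.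
  rewrite ger0_norm ?addr_ge0 ?nn//.
  by have := sqr_ge0 (a * u w - b * v w); nra.
- exact: (integrableD measurableT (integrableZl measurableT _ iu)
    (integrableZl measurableT _ iv)).
Qed.

Lemma real_L2_mul_integrable u v : real_L2 u -> real_L2 v ->
  P.-integrable setT (EFin \o (fun w => u w * v w)).
Proof.
move=> [mu iu] [mv iv].
have mu' := FM_measurable_fun _ mu; have mv' := FM_measurable_fun _ mv.
apply: (le_integrable measurableT
   (g := fun w => ((u w ^+ 2)%:E + (v w ^+ 2)%:E)%E)).
- by apply/measurable_EFinP; exact: measurable_funM.
- move=> w _; rewrite -EFinD !abse_EFin lee_fin.
  rewrite [leRHS]ger0_norm ?addr_ge0 ?sqr_ge0// ler_norml.
  (* The two squares bound the product from above and from below. *)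
  by have := sqr_ge0 (u w - v w); have := sqr_ge0 (u w + v w); nra.
- exact: (integrableD measurableT iu iv).
Qed.

Lemma real_L2_E_lin (a b : R) t u v : real_L2 t -> real_L2 u -> real_L2 v ->
  E P (fun w => t w * (a * u w + b * v w)) =
  a * E P (fun w => t w * u w) + b * E P (fun w => t w * v w).
Proof.
move=> Lt Lu Lv; rewrite /E.
have iu := real_L2_mul_integrable _ _ Lt Lu.
have iv := real_L2_mul_integrable _ _ Lt Lv.
rewrite -!RintegralZl// -RintegralD//.
- by apply: eq_Rintegral => w _; ring.
- by have := integrableZl measurableT a iu.
- by have := integrableZl measurableT b iv.
Qed.

Lemma L2M_real_L2 xi : L2M P M xi <->
  real_L2 (fun w => cre (xi w)) /\ real_L2 (fun w => cim (xi w)).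
Proof. by split=> [[a b c e]|[[a b] [c e]]]; do !split. Qed.

Lemma L2M_lin a xi eta : L2M P M xi -> L2M P M eta ->
  L2M P M (fun w => a * xi w + eta w).
Proof.
move=> /L2M_real_L2[rx ix] /L2M_real_L2[re ie]; apply/L2M_real_L2; split.
  rewrite [X in real_L2 X](_ : _ = fun w => 1 * (cre a * cre (xi w)
      + (- cim a) * cim (xi w)) + 1 * cre (eta w)).
    by apply: real_L2_lin => //; exact: real_L2_lin.
  by apply/funext => w; rewrite creD creM; ring.
rewrite [X in real_L2 X](_ : _ = fun w => 1 * (cre a * cim (xi w)
    + cim a * cre (xi w)) + 1 * cim (eta w)).
  by apply: real_L2_lin => //; exact: real_L2_lin.
by apply/funext => w; rewrite cimD cimM; ring.
Qed.

(** Each [Z_s] is real-valued, so the conjugation in the first argument disappears. *)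
Lemma ip_ZsC s xi : ip P (ZsC M s) xi =
  E P (fun w => Zs M s w * cre (xi w)) +i* E P (fun w => Zs M s w * cim (xi w)).
Proof.
rewrite /ip; congr (_ +i* _); congr (E P _); apply/funext => w;
  by rewrite /ZsC /cre /cim/= ?mul0r ?addr0 ?subr0.
Qed.

Lemma ip_lin s a xi eta : L2M P M (ZsC M s) -> L2M P M xi -> L2M P M eta ->
  ip P (ZsC M s) (fun w => a * xi w + eta w) =
  a * ip P (ZsC M s) xi + ip P (ZsC M s) eta.
Proof.
move=> /L2M_real_L2[Ls _] /L2M_real_L2[rx ix] /L2M_real_L2[re ie].
rewrite !ip_ZsC.
have -> : (fun w => Zs M s w * cre (a * xi w + eta w)) =
   fun w => Zs M s w * (1 * (cre a * cre (xi w) + (- cim a) * cim (xi w)) + 1 * cre (eta w)).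
  by apply/funext => w; rewrite creD creM; ring.
have -> : (fun w => Zs M s w * cim (a * xi w + eta w)) =
   fun w => Zs M s w * (1 * (cre a * cim (xi w) + cim a * cre (xi w)) + 1 * cim (eta w)).
  by apply/funext => w; rewrite cimD cimM; ring.
have Ls' : real_L2 (Zs M s) by [].
rewrite !real_L2_E_lin//; try exact: real_L2_lin.
by case: a => a b; apply: cplx_eq;
  rewrite ?creD ?cimD ?creM ?cimM /cre /cim /=; ring.
Qed.

End RealSquareIntegrable.

(** * Chaos coefficients and weighted norms along an enumeration of Gamma *)

Section ChaosCoefficients.
Context {R : realType} {d : measure_display} {Omega : measurableType d}.
Variables (P : probability Omega R) (M : nat -> Omega -> R).
Hypothesis measM : forall n, measurable_fun setT (M n).
Hypothesis Z_L2M : forall s, L2M P M (ZsC M s).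
Hypothesis Z_orthonormal :
  forall s t, ip P (ZsC M s) (ZsC M t) = (if s == t then 1 else 0).
Variable f : nat -> {fset nat}.
Hypothesis f_inj : injective f.
Hypothesis f_surj : forall s, exists n, f n = s.

Definition wt (p n : nat) : R := (lam (f n))%:R ^+ (2 * p).
Definition coef (xi : Omega -> R[i]) (n : nat) : R[i] := ip P (ZsC M (f n)) xi.
(** Partial sums of the squared norm of index [p] along [f]; the estimates are carried out on
    these. *)
Definition psum p xi N : R :=
  \sum_(0 <= n < N) wt p n * cabs (coef xi n) ^+ 2.
Definition comb N (a : nat -> R[i]) : Omega -> R[i] :=
  fun w => \sum_(0 <= n < N) a n * ZsC M (f n) w.

Lemma wt_ge0 p n : 0 <= wt p n.
Proof. by rewrite exprn_ge0// ler0n. Qed.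

(** The weights of index [p.+1] and [p] differ by the factor [lam ^ 2], which absorbs the squared
    multiplier at the cost of one index. *)
Lemma multiplier_wt p n (t A : R) : `|t| <= A * (lam (f n))%:R ->
  wt p n * `|t| ^+ 2 <= A ^+ 2 * wt p.+1 n.
Proof.
move=> ht; rewrite {2}/wt mulnS exprD mulrA -exprMn mulrC ler_wpM2r ?wt_ge0//.
by rewrite ler_pXn2r ?nnegrE// (le_trans _ ht).
Qed.

Lemma psum_nd p xi : nondecreasing_seq (psum p xi).
Proof.
move=> m n mn; rewrite /psum (big_cat_nat (leq0n _) mn)//= lerDl sumr_ge0// => i _.
by rewrite mulr_ge0 ?wt_ge0 ?sqr_ge0.
Qed.

(** The terms are nonnegative, so the unordered sum over Gamma is the series along the bijection
    [f]. *)
Lemma normsq_cvg p xi : (psum p xi N)%:E @[N --> \oo] --> normsq P M p xi.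
Proof.
rewrite /normsq (@reindex_esum R _ _ [set: nat] [set: {fset nat}] f); last first.
  split=> //; first by move=> x y _ _; exact: f_inj.
  by move=> s _; have [n <-] := f_surj s; exists n.
rewrite -nneseries_esumT; last first.
  by move=> n; rewrite lee_fin mulr_ge0 ?sqr_ge0// wt_ge0.
rewrite (_ : (fun N => _) = fun N => (\sum_(0 <= n < N)
   ((lam (f n))%:R ^+ (2 * p) * cabs (ip P (ZsC M (f n)) xi) ^+ 2)%:E)%E).
  by apply: is_cvg_nneseries => n _ _; rewrite lee_fin mulr_ge0 ?sqr_ge0 ?wt_ge0.
by apply/funext => N; rewrite sumEFin.
Qed.

Lemma normsq_le p xi (b : R) :
  (forall N, psum p xi N <= b) -> (normsq P M p xi <= b%:E)%E.
Proof.
move=> le; have h := normsq_cvg p xi; rewrite -(cvg_lim _ h)//.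
by apply: lime_le; [apply/cvg_ex; eexists; exact: h|apply: nearW => N; rewrite lee_fin].
Qed.

Lemma psum_le_normsq p xi N : ((psum p xi N)%:E <= normsq P M p xi)%E.
Proof.
have h := normsq_cvg p xi; rewrite -(cvg_lim _ h)//.
apply: lime_ge; first by apply/cvg_ex; eexists; exact: h.
by exists N => // n /= Nn; rewrite lee_fin; exact: psum_nd.
Qed.

Lemma normsq_fin p xi : (normsq P M p xi < +oo)%E ->
  exists b : R, normsq P M p xi = b%:E /\ psum p xi N @[N --> \oo] --> b.
Proof.
move=> fin; have h := normsq_cvg p xi.
have ge0 : (0 <= normsq P M p xi)%E.
  by apply: le_trans (psum_le_normsq p xi 0); rewrite /psum big_geq.
move: h fin ge0; case: (normsq P M p xi) => [b| |]// h _ _.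
by exists b; split => //; exact: (fine_cvg h).
Qed.

Lemma comb0 a : comb 0 a = fun=> 0.
Proof. by apply/funext => w; rewrite /comb big_geq. Qed.

Lemma combS N a : comb N.+1 a = fun w => a N * ZsC M (f N) w + comb N a w.
Proof. by apply/funext => w; rewrite /comb big_nat_recr//= addrC. Qed.

Lemma L2M0 : L2M P M (fun=> 0).
Proof.
(* Zero is written as [-1 * Z + Z] with [Z] the basis element of the empty set, which reduces the
   claim to closure under combinations. *)
have := L2M_lin _ _ measM (-1) _ _ (Z_L2M fset0) (Z_L2M fset0).
by congr (L2M P M _); apply/funext => w; rewrite mulN1r addNr.
Qed.

Lemma comb_L2M N a : L2M P M (comb N a).
Proof.
elim: N => [|N ih]; first by rewrite comb0; exact: L2M0.
by rewrite combS; apply: L2M_lin.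
Qed.

Lemma coef_lin a xi eta n : L2M P M xi -> L2M P M eta ->
  coef (fun w => a * xi w + eta w) n = a * coef xi n + coef eta n.
Proof. by move=> Lx Le; rewrite /coef ip_lin. Qed.

Lemma coef_Z n k : coef (ZsC M (f k)) n = if n == k then 1 else 0.
Proof. by rewrite /coef Z_orthonormal (inj_eq f_inj). Qed.

Lemma coef_comb N a n : coef (comb N a) n = if (n < N)%N then a n else 0.
Proof.
elim: N => [|N ih].
  rewrite comb0 (_ : (fun=> 0) = fun w => -1 * ZsC M fset0 w + ZsC M fset0 w).
    by rewrite coef_lin// mulN1r addNr.
  by apply/funext => w; rewrite mulN1r addNr.
rewrite combS coef_lin//; last exact: comb_L2M.
by rewrite coef_Z ih ltnS; case: (ltngtP n N) => [_|_|->];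
  rewrite ?mulr0 ?mulr1 ?addr0 ?add0r.
Qed.

Lemma psum_comb_le p N a K :
  psum p (comb N a) K <= \sum_(0 <= n < N) wt p n * cabs (a n) ^+ 2.
Proof.
(* Raising [K] to at least [N] allows a split at [N], beyond which all coefficients vanish. *)
apply: (@le_trans _ _ (psum p (comb N a) (maxn K N))).
  by apply: psum_nd; rewrite leq_maxl.
rewrite /psum (big_cat_nat (leq0n _) (leq_maxr K N))//= [X in _ + X]big1_seq ?addr0.
  rewrite le_eqVlt; apply/orP; left; apply/eqP.
  by apply: eq_big_nat => n /andP[_ nN]; rewrite coef_comb nN.
move=> n /andP[_]; rewrite mem_index_iota => /andP[Nn _].
by rewrite coef_comb ltnNge Nn/= cabs0 expr0n mulr0.
Qed.

Lemma normsq_comb_le p N a :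
  (normsq P M p (comb N a) <= (\sum_(0 <= n < N) wt p n * cabs (a n) ^+ 2)%:E)%E.
Proof. by apply: normsq_le => K; exact: psum_comb_le. Qed.

Lemma SM_comb N a : SM P M (comb N a).
Proof.
split; first exact: comb_L2M.
by move=> p; apply: le_lt_trans (normsq_comb_le p N a) _; rewrite ltry.
Qed.

Lemma SM_Z s : SM P M (ZsC M s).
Proof.
have [n <-] := f_surj s.
rewrite (_ : ZsC M (f n) = comb n.+1 (fun k => if k == n then 1 else 0)).
  exact: SM_comb.
apply/funext => w; rewrite /comb big_nat_recr//= eqxx mul1r.
rewrite big1_seq ?add0r// => k /andP[_]; rewrite mem_index_iota => /andP[_ kn].
by rewrite ltn_eqF// mul0r.
Qed.

Lemma SM_lin a xi eta : SM P M xi -> SM P M eta ->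
  SM P M (fun w => a * xi w + eta w).
Proof.
move=> [Lx nx] [Le ne]; split; first exact: L2M_lin.
move=> p; have [bx [hx _]] := normsq_fin _ _ (nx p).
have [be [he _]] := normsq_fin _ _ (ne p).
(* The constant comes from applying [cabs_sqrD] to each coefficient. *)
apply: (@le_lt_trans _ _ (2 * (cabs a ^+ 2 * bx + be))%:E); last by rewrite ltry.
apply: normsq_le => N.
have := psum_le_normsq p xi N; have := psum_le_normsq p eta N.
rewrite hx he !lee_fin => le1 le2.
apply: (@le_trans _ _ (2 * (cabs a ^+ 2 * psum p xi N + psum p eta N))).
  rewrite /psum mulr_sumr -big_split/= mulr_sumr ler_sum// => n _.
  rewrite coef_lin//.
  rewrite [leRHS](_ : _ = wt p n * (2 * (cabs (a * coef xi n) ^+ 2 + cabs (coef eta n) ^+ 2))).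
    by rewrite ler_wpM2l ?wt_ge0 ?cabs_sqrD.
  by rewrite cabsM; ring.
by rewrite ler_pM2l// lerD// ler_wpM2l ?sqr_ge0.
Qed.

Lemma SM0 : SM P M (fun=> 0).
Proof. by rewrite -(comb0 (fun=> 0)); exact: SM_comb. Qed.

(** * Continuous functionals evaluated on truncated expansions *)

Section Functional.
Variable Phi : dual R Omega.
Hypothesis Phi_dual : SMdual P M Phi.

Lemma SMdual_lin a xi eta : SM P M xi -> SM P M eta ->
  Phi (fun w => a * xi w + eta w) = a * Phi xi + Phi eta.
Proof. by case: Phi_dual => + _ _; apply. Qed.

Lemma SMdual0 : Phi (fun=> 0) = 0.
Proof.
rewrite (_ : (fun=> 0) = fun w : Omega => -1 * (0 : R[i]) + (0 : R[i])).
  by rewrite SMdual_lin ?mulN1r ?addNr//; exact: SM0.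
by apply/funext => w; rewrite mulr0 addr0.
Qed.

Lemma SMdual_comb N a : Phi (comb N a) = \sum_(0 <= n < N) a n * Phi (ZsC M (f n)).
Proof.
elim: N => [|N ih]; first by rewrite comb0 SMdual0 big_geq.
by rewrite combS SMdual_lin ?big_nat_recr//= ?ih 1?addrC//;
  [exact: SM_Z|exact: SM_comb].
Qed.

(** Continuity restated through finite partial sums. Replacing [C] by [Num.max C 0] makes the
    constant nonnegative, so that inequalities can be multiplied by it. *)
Lemma SMdual_bound : exists p (C : R), 0 <= C /\
  forall xi b, SM P M xi -> (forall N, psum p xi N <= b) ->
    cabs (Phi xi) ^+ 2 <= C * b.
Proof.
case: Phi_dual => _ [p [C hC]] _; exists p, (Num.max C 0).
split; first by rewrite le_max lexx orbT.
move=> xi b Sx hb.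
have [b' [hb' _]] := normsq_fin _ _ (Sx.2 p).
have b'b : b' <= b by rewrite -lee_fin -hb'; exact: normsq_le.
have b'0 : 0 <= b'.
  by have := psum_le_normsq p xi 0; rewrite hb' lee_fin /psum big_geq.
have := hC _ Sx; rewrite hb' -EFinM lee_fin => /le_trans; apply.
apply: (@le_trans _ _ (Num.max C 0 * b')).
  by rewrite ler_wpM2r// le_max lexx.
by rewrite ler_wpM2l// le_max lexx orbT.
Qed.

(** The remainder of the truncated expansion has squared [p]-norm at most the tail
    [b - psum p xi N], which tends to 0, and [Phi] is [p]-continuous. *)
Lemma SMdual_expansion xi : SM P M xi ->
  cplx_cvg (fun N => Phi (comb N (coef xi))) (Phi xi).
Proof.
move=> Sx; have [p [C [C0 hC]]] := SMdual_bound.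
have [b [hb cb]] := normsq_fin _ _ (Sx.2 p).
apply: cplx_cvg_sqr0.
have bnd N : cabs (Phi (comb N (coef xi)) - Phi xi) ^+ 2 <= C * (b - psum p xi N).
  pose rest := fun w => -1 * comb N (coef xi) w + xi w.
  have Srest : SM P M rest := SM_lin (-1) _ _ (SM_comb N (coef xi)) Sx.
  have crest n : coef rest n = if (n < N)%N then 0 else coef xi n.
    rewrite (coef_lin _ _ _ _ (comb_L2M _ _) Sx.1) coef_comb.
    by case: ifP => _; rewrite mulN1r ?addNr ?oppr0 ?add0r.
  have -> : Phi (comb N (coef xi)) - Phi xi = - Phi rest.
    by rewrite (SMdual_lin _ _ _ (SM_comb _ _) Sx) mulN1r opprD opprK.
  rewrite cabsN; apply: (hC rest _ Srest) => K.
  (* The remainder has zero coefficients below [N] and those of [xi] from [N] on, so its partial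
     sums are increments of [psum p xi]. *)
  apply: (@le_trans _ _ (psum p xi (maxn K N) - psum p xi N)); last first.
    by rewrite lerB// -lee_fin -hb; exact: psum_le_normsq.
  apply: (@le_trans _ _ (psum p rest (maxn K N))).
    by apply: psum_nd; rewrite leq_maxl.
  rewrite lerBrDl /psum !(big_cat_nat (leq0n _) (leq_maxr K N))//=.
  rewrite [X in _ + (X + _)]big1_seq ?add0r; last first.
    move=> n /andP[_]; rewrite mem_index_iota => /andP[_ nN].
    by rewrite crest nN cabs0 expr0n mulr0.
  rewrite lerD2l le_eqVlt; apply/orP; left; apply/eqP.
  by apply: eq_big_nat => n /andP[Nn _]; rewrite crest ltnNge Nn.
apply: (@squeeze_cvgr _ _ _ _ (fun=> 0) (fun N => C * (b - psum p xi N))).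
- by apply: nearW => N; rewrite sqr_ge0 bnd.
- exact: cvg_cst.
- rewrite -(mulr0 C) -(subrr b); apply: cvgMr; apply: cvgB => //; exact: cvg_cst.
Qed.

(** The increments of the sequence are values of [Phi] on blocks of the multiplied expansion; their
    squared [p]-norms are at most [A ^+ 2] times increments of the convergent sequence
    [psum p.+1 xi]. *)
Lemma multiplier_cvg (th : nat -> R) (A : R) xi :
  (forall n, `|th n| <= A * (lam (f n))%:R) -> SM P M xi ->
  exists z, cplx_cvg (fun N => Phi (comb N (fun n => (th n)%:C * coef xi n))) z.
Proof.
move=> hth Sx; have [p [C [C0 hC]]] := SMdual_bound.
have [b [hb cb]] := normsq_fin _ _ (Sx.2 p.+1).
apply: (@cplx_cauchy_cvg _ _ (fun N => C * A ^+ 2 * psum p.+1 xi N)).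
  by apply/cvg_ex; exists (C * A ^+ 2 * b); exact: cvgMr.
move=> m n mn; set a := fun n => _.
(* Zeroing the coefficients below [m] turns the difference into a single value of [Phi] on a finite
   combination. *)
pose a' k := if (k < m)%N then 0 else a k.
have -> : Phi (comb n a) - Phi (comb m a) = Phi (comb n a').
  rewrite !SMdual_comb !(big_cat_nat (leq0n _) mn)//= addrAC subrr add0r.
  rewrite [X in _ = X + _]big1_seq ?add0r.
    by apply: eq_big_nat => k /andP[mk _]; rewrite /a' ltnNge mk.
  move=> k /andP[_]; rewrite mem_index_iota => /andP[_ km].
  by rewrite /a' km mul0r.
apply: le_trans (hC _ _ (SM_comb _ _) (psum_comb_le p n a')) _.
rewrite -mulrBr -mulrA ler_wpM2l// /psum !(big_cat_nat (leq0n _) mn)//= [in leRHS]addrAC subrr add0r.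
rewrite [X in X + _ <= _]big1_seq ?add0r; last first.
  move=> k /andP[_]; rewrite mem_index_iota => /andP[_ km].
  by rewrite /a' km cabs0 expr0n mulr0.
rewrite mulr_sumr; apply: ler_sum_nat => k /andP[mk _].
rewrite /a' ltnNge mk/= /a cabsM exprMn cabs_real mulrA [leRHS]mulrA.
by rewrite ler_wpM2r ?sqr_ge0// multiplier_wt.
Qed.

End Functional.
End ChaosCoefficients.

(** * Growth of the spectral function *)

Section SpectralBound.
Context {R : realType}.

(** Every factor is at least 2, so the product at least doubles with each new element. *)
Lemma size_ltn_prod_succ (r : seq nat) : 0%N \notin r ->
  (size r < \prod_(k <- r) k.+1)%N.
Proof.
elim: r => [|x r ih]; first by rewrite big_nil.
rewrite inE negb_or => /andP[x0 /ih]; rewrite big_cons /=.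
set q := (X in (_ < X)%N) => hq.
have : (2 * q <= x.+1 * q)%N by rewrite leq_mul2r; case: x x0 => // x _; rewrite orbT.
lia.
Qed.

(** The element 0 contributes only the factor 1. It is removed, and the strict inequality for the
    remaining elements makes up for the one lost. *)
Lemma card_le_lam (s : {fset nat}) : (size s <= lam s)%N.
Proof.
rewrite /lam; case: (boolP (0%N \in s)) => [s0|/size_ltn_prod_succ/ltnW//].
have us := fset_uniq s.
rewrite (perm_size (perm_to_rem s0)) (perm_big _ (perm_to_rem s0)) /= big_cons mul1n.
by apply: size_ltn_prod_succ; rewrite mem_rem_uniq// inE eqxx.
Qed.

Lemma esum_indicator (s : {fset nat}) (a : nat -> \bar R) (b : R) :
  (forall k, 0 <= a k)%E -> (forall k, a k <= b%:E)%E ->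
  (\esum_(k in [set: nat]) (ind s k)%:E * a k <= (b * (size s)%:R)%:E)%E.
Proof.
move=> a0 ab.
rewrite (_ : esum _ _ = \esum_(k in [set` s]) a k)%E; last first.
  rewrite [RHS]esum_mkcond; apply: eq_esum => k _; rewrite /ind.
  by rewrite mem_setE; case: ifP => ks; rewrite ?mul1e ?mul0e.
rewrite esum_fset; [|exact: finite_fset|by []].
rewrite -fsbig_seq ?fset_uniq//.
apply: (@le_trans _ _ (\sum_(i <- s) b%:E)%E); first exact: lee_sum.
by rewrite sumEFin big_const_seq count_predT iter_addr_0 mulr_natr.
Qed.

(** Each of the two sums is at most [A] times the cardinality of [s]: diagonal entries are bounded
    by column sums, and with [1 - ind s j <= 1] the double sum is bounded by the columns indexed by
    [s]. *)
Lemma spectral_le (w : nat -> nat -> R) : is_2Dweight w ->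
  exists A : R, forall s, `|spectral w s| <= A * (lam s)%:R.
Proof.
move=> [w0 [A hA]].
have w0E j k : (0 <= (w j k)%:E)%E by rewrite lee_fin.
have A0 : 0 <= A by rewrite -lee_fin (le_trans _ (hA 0%N))// esum_ge0.
have wA j k : ((w j k)%:E <= A%:E)%E.
  apply: le_trans (hA k); apply: esum_ge; exists [set j].
    by split; [exact: finite_set1|].
  by rewrite fsbig_set1.
exists (2 * A) => s; rewrite /spectral; set x := esum _ _; set y := esum _ _.
have ind0 k : 0 <= ind s k :> R by rewrite /ind; case: ifP.
have indC0 k : 0 <= 1 - ind s k :> R by rewrite /ind; case: ifP; rewrite ?subrr ?subr0.
have indC1 k : 1 - ind s k <= 1 :> R by rewrite lerBlDr lerDl.
have x0 : (0 <= x)%E by apply: esum_ge0 => k _; rewrite lee_fin mulr_ge0.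
have y0 : (0 <= y)%E by apply: esum_ge0 => k _; rewrite lee_fin !mulr_ge0.
have xle : (x <= (A * (size s)%:R)%:E)%E.
  by rewrite /x; under eq_esum do rewrite EFinM; exact: esum_indicator.
have yle : (y <= (A * (size s)%:R)%:E)%E.
  (* The coordinates are swapped so that the outer sum runs over the column index, where [hA]
     applies. *)
  rewrite /y (@reindex_esum R _ _ [set: nat * nat] [set: nat * nat] (fun p => (p.2, p.1))).
  apply: (@le_trans _ _ (\esum_(p in [set: nat] `*`` (fun=> [set: nat]))
      ((ind s p.1)%:E * (w p.2 p.1)%:E))%E).
    rewrite (_ : _ `*`` _ = [set: nat * nat]); last by apply/seteqP; split.
    apply: le_esum => -[k j] _ /=; rewrite -EFinM lee_fin.
    by rewrite ler_wpM2r// ler_piMl.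
  rewrite -(@esum_esum _ _ _ _ _ (fun k j => (ind s k)%:E * (w j k)%:E)%E); last first.
    by move=> k j _ _; rewrite -EFinM lee_fin mulr_ge0.
  apply: le_trans (esum_indicator s (fun k => \esum_(j in [set: nat]) (w j k)%:E)%E A _ hA).
    apply: le_esum => k _; rewrite /ind; case: ifP => ks.
      by rewrite mul1e; apply: le_esum => j _; rewrite mul1e.
    by rewrite mul0e esum1// => j _; rewrite mul0e.
  by move=> k; apply: esum_ge0.
  split=> // [[a b] [c e] _ _ [-> ->]//|[a b] _]; by exists (b, a).
have : (x + y <= (2 * A * (lam s)%:R)%:E)%E.
  apply: le_trans (leeD xle yle) _; rewrite -EFinD lee_fin.
  have : (size s)%:R <= (lam s)%:R :> R by rewrite ler_nat card_le_lam.
  by move: A0; nra.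
(* Nonnegativity and the finite upper bound rule out infinite values, on which [fine] would return
   its default 0. *)
have : (0 <= x + y)%E by rewrite adde_ge0.
by case: (x + y)%E => // r; rewrite !lee_fin => r0 rle; rewrite ger0_norm.
Qed.

End SpectralBound.

(** Gamma is countable, and infinite because it contains the singletons. *)
Lemma fset_nat_enumeration :
  exists f : nat -> {fset nat}, injective f /\ forall s, exists n, f n = s.
Proof.
have : ([set: {fset nat}] #= [set: nat])%card.
  apply: eq_card_nat; first exact: countableP.
  apply/infiniteP/pcard_leTP/injPex; exists (fun n => [fset n]%fset) => // m n _ _.
  by move=> /fsetP/(_ m); rewrite !inE eqxx => /esym/eqP.
rewrite card_eq_sym => /card_set_bijP[f [_ fi fs]]; exists f; split.
  by move=> m n; apply: fi; rewrite inE.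
by move=> s; have [n _ <-] := fs s I; exists n.
Qed.

(** * The diagonal operator on S*(M) and its continuity *)

Section DiagonalOperator.
Context {R : realType} {d : measure_display} {Omega : measurableType d}.
Variables (P : probability Omega R) (M : nat -> Omega -> R).
Hypothesis measM : forall n, measurable_fun setT (M n).
Hypothesis Z_L2M : forall s, L2M P M (ZsC M s).
Hypothesis Z_orthonormal :
  forall s t, ip P (ZsC M s) (ZsC M t) = (if s == t then 1 else 0).
Variable f : nat -> {fset nat}.
Hypothesis f_inj : injective f.
Hypothesis f_surj : forall s, exists n, f n = s.
Variables (th : nat -> R) (A : R).
Hypothesis th_le : forall n, `|th n| <= A * (lam (f n))%:R.

Definition trunc N (xi : Omega -> R[i]) : Omega -> R[i] :=
  comb M f N (fun n => (th n)%:C * coef P M f xi n).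

(** [xget] selects the limit. The value 0 outside S(M) follows the convention by which elements of
    S*(M) are represented. *)
Definition diag_op (Phi : dual R Omega) : dual R Omega := fun xi =>
  if `[< SM P M xi >] then xget 0 [set z | cplx_cvg (fun N => Phi (trunc N xi)) z]
  else 0.

Lemma trunc_SM N xi : SM P M (trunc N xi).
Proof. exact: SM_comb. Qed.

(** The boundedness of T_N from S_(p+1) to S_p; the right-hand side is controlled by [normsq] of
    index [p.+1], whatever [N] and [K]. *)
Lemma psum_trunc_le p xi N K :
  psum P M f p (trunc N xi) K <= A ^+ 2 * psum P M f p.+1 xi N.
Proof.
apply: le_trans (psum_comb_le _ _ measM Z_L2M Z_orthonormal _ f_inj _ _ _ _) _.
rewrite mulr_sumr ler_sum// => n _.
rewrite cabsM exprMn cabs_real [leLHS]mulrA [leRHS]mulrA ler_wpM2r ?sqr_ge0//.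
exact: multiplier_wt.
Qed.

Lemma trunc_lin N a xi eta : SM P M xi -> SM P M eta ->
  trunc N (fun w => a * xi w + eta w) = fun w => a * trunc N xi w + trunc N eta w.
Proof.
move=> [Lx _] [Le _]; apply/funext => w.
rewrite /trunc /comb mulr_sumr -big_split/=; apply: eq_bigr => n _.
by rewrite coef_lin//; ring.
Qed.

Lemma diag_opP Phi xi : SMdual P M Phi -> SM P M xi ->
  cplx_cvg (fun N => Phi (trunc N xi)) (diag_op Phi xi).
Proof.
move=> dPhi Sx; rewrite /diag_op asboolT//.
have [z hz] := multiplier_cvg _ _ measM Z_L2M Z_orthonormal _ f_inj f_surj
  _ dPhi th A xi th_le Sx.
exact: (@xgetI _ 0 [set z | cplx_cvg (fun N => Phi (trunc N xi)) z] z hz).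
Qed.

Lemma diag_op_out Phi xi : ~ SM P M xi -> diag_op Phi xi = 0.
Proof. by move=> Sx; rewrite /diag_op asboolF. Qed.

Lemma diag_op_SMdual Phi : SMdual P M Phi -> SMdual P M (diag_op Phi).
Proof.
move=> dPhi; split; last by move=> xi; exact: diag_op_out.
- move=> a xi eta Sx Se.
  have Sl : SM P M (fun w => a * xi w + eta w).
    exact: (SM_lin _ _ measM Z_L2M _ f_inj f_surj _ _ _ Sx Se).
  apply: cplx_cvg_unique (diag_opP _ _ dPhi Sl) _.
  under eq_fun do rewrite trunc_lin// (SMdual_lin _ _ _ dPhi _ _ _ (trunc_SM _ _) (trunc_SM _ _)).
  by apply: cplx_cvgD; [apply: cplx_cvgM|]; exact: diag_opP.
- have [p [C [C0 hC]]] := SMdual_bound _ _ _ f_inj f_surj _ dPhi.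
  exists p.+1, (C * A ^+ 2) => xi Sx.
  have [b [hb _]] := normsq_fin _ _ _ f_inj f_surj _ _ (Sx.2 p.+1).
  rewrite hb -EFinM lee_fin.
  apply: cplx_cvg_cabs_sqr_le (diag_opP _ _ dPhi Sx) _ => N.
  rewrite -mulrA; apply: hC => [|K]; first exact: trunc_SM.
  apply: le_trans (psum_trunc_le _ _ _ _) _.
  by rewrite ler_wpM2l ?sqr_ge0// -lee_fin -hb; exact: psum_le_normsq.
Qed.

Lemma diag_op_lin a Phi Psi : SMdual P M Phi -> SMdual P M Psi ->
  diag_op (fun xi => a * Phi xi + Psi xi) =
  fun xi => a * diag_op Phi xi + diag_op Psi xi.
Proof.
move=> dPhi dPsi; apply/funext => xi.
have [Sx|Sx] := pselect (SM P M xi); last first.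
  by rewrite !diag_op_out// mulr0 addr0.
have c : cplx_cvg (fun N => a * Phi (trunc N xi) + Psi (trunc N xi))
    (a * diag_op Phi xi + diag_op Psi xi).
  by apply: cplx_cvgD; [apply: cplx_cvgM|]; exact: diag_opP.
(* Since [c] exhibits a limit, [xget] returns a limit of the same sequence, and the two agree by
   uniqueness. *)
apply: (cplx_cvg_unique _ _ _ _ c); rewrite {1}/diag_op asboolT//.
exact: (@xgetI _ 0 [set z | cplx_cvg
  (fun N => a * Phi (trunc N xi) + Psi (trunc N xi)) z] _ c).
Qed.

Lemma diag_op_fock Phi n : SMdual P M Phi ->
  diag_op Phi (ZsC M (f n)) = (th n)%:C * Phi (ZsC M (f n)).
Proof.
move=> dPhi.
have SZ := SM_Z _ _ measM Z_L2M Z_orthonormal _ f_inj f_surj.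
apply: cplx_cvg_unique (diag_opP _ _ dPhi (SZ (f n))) _.
apply: cplx_cvg_near (cplx_cvg_cst _).
(* From [n.+1] on the truncation contains the index [n], the only nonzero term, so the sequence is
   constant. *)
exists n.+1 => // N /= nN.
rewrite (SMdual_comb _ _ measM Z_L2M Z_orthonormal _ f_inj f_surj _ dPhi).
rewrite (bigD1_seq n) ?mem_index_iota ?iota_uniq//= coef_Z// eqxx mulr1.
rewrite big1_seq ?addr0// => k /andP[kn _].
by rewrite coef_Z// (negbTE kn) mulr0 mul0r.
Qed.

(* For bounded [B], the truncated images of the elements of [B] form a bounded
   set on which smallness of [Psi - Phi] passes to the limit, giving smallness
   of [diag_op Psi - diag_op Phi] on [B]. *)
Lemma diag_op_continuous U : strong_open P M U ->
  strong_open P M [set Phi | SMdual P M Phi /\ U (diag_op Phi)].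
Proof.
move=> [_ openU]; split; first by move=> Phi [].
move=> Phi [dPhi /openU[B [e [[BSM Bb] e0 BU]]]].
exists [set trunc x.1 x.2 | x in [set x : nat * (Omega -> R[i]) | B x.2]], (e / 2).
split.
- split; first by move=> _ [x _ <-]; exact: trunc_SM.
  move=> p; have [C hC] := Bb p.+1; exists (A ^+ 2 * C) => _ [[N xi] /= Bx <-].
  apply: (normsq_le _ _ _ f_inj f_surj) => K.
  apply: le_trans (psum_trunc_le _ _ _ _) _.
  rewrite ler_wpM2l ?sqr_ge0// -lee_fin.
  exact: le_trans (psum_le_normsq _ _ _ f_inj f_surj _ _ _) (hC _ Bx).
- by rewrite divr_gt0.
move=> Psi [dPsi hPsi]; split=> //; apply: BU; split; first exact: diag_op_SMdual.
(* Limits and suprema preserve only weak inequalities; halving [e] recovers the strict one. *)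
apply: (@le_lt_trans _ _ (e / 2)%:E); last by rewrite lte_fin ltr_pdivrMr// ltr_pMr// ltr1n.
apply: ge_ereal_sup => _ [xi Bx <-]; rewrite lee_fin.
have Sx := BSM _ Bx.
have c : cplx_cvg (fun N => Psi (trunc N xi) - Phi (trunc N xi))
    (diag_op Psi xi - diag_op Phi xi).
  rewrite -mulN1r; under eq_fun do rewrite -mulN1r.
  by apply: cplx_cvgD; [|apply: cplx_cvgM]; exact: diag_opP.
apply: cplx_cvg_cabs_le c _; first by rewrite divr_ge0// ltW.
move=> N; rewrite -lee_fin; apply: le_trans (ltW hPsi).
by apply: ereal_sup_ubound; exists (trunc N xi) => //; exists (N, xi).
Qed.

Lemma diag_op_cont_lin : cont_lin_op P M diag_op.
Proof.
split; [exact: diag_op_SMdual|exact: diag_op_lin|exact: diag_op_continuous].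
Qed.

End DiagonalOperator.

(** * Uniqueness through the Fock transform, and the theorem *)

Lemma SMdual_fock_inj (R : realType) (d : measure_display) (Omega : measurableType d)
    (P : probability Omega R) (M : nat -> Omega -> R)
    (measM : forall n, measurable_fun setT (M n))
    (Z_L2M : forall s, L2M P M (ZsC M s))
    (Z_orthonormal :
      forall s t, ip P (ZsC M s) (ZsC M t) = (if s == t then 1 else 0))
    (Phi Psi : dual R Omega) :
  SMdual P M Phi -> SMdual P M Psi -> fock M Phi =1 fock M Psi -> Phi = Psi.
Proof.
move=> dPhi dPsi eqF; have [f [f_inj f_surj]] := fset_nat_enumeration.
apply/funext => xi; have [Sx|Sx] := pselect (SM P M xi); last first.
  (* Outside S(M) both functionals are 0 by convention. *)
  by case: dPhi dPsi => _ _ -> // [_ _ ->].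
have expansion := SMdual_expansion _ _ measM Z_L2M Z_orthonormal _ f_inj f_surj.
have comb_eq := SMdual_comb _ _ measM Z_L2M Z_orthonormal _ f_inj f_surj.
apply: cplx_cvg_unique (expansion _ dPhi _ Sx) _.
apply: cplx_cvg_near (expansion _ dPsi _ Sx); apply: nearW => N.
rewrite !comb_eq//; apply: eq_bigr => n _; congr (_ * _).
by have := eqF (f n).
Qed.

Theorem theorem3p2 (R : realType) (d : measure_display) (Omega : measurableType d)
    (P : probability Omega R) (M : nat -> Omega -> R)
    (hM : normal_martingale P M) (hCRP : CRP P M)
    (w : nat -> nat -> R) (hw : is_2Dweight w) :
  exists K : dual R Omega -> dual R Omega,
    [/\ cont_lin_op P M K,
        (forall Phi, SMdual P M Phi -> forall s : {fset nat},
           fock M (K Phi) s = (spectral w s)%:C * fock M Phi s) &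
        (forall K' : dual R Omega -> dual R Omega, cont_lin_op P M K' ->
           (forall Phi, SMdual P M Phi -> forall s : {fset nat},
              fock M (K' Phi) s = (spectral w s)%:C * fock M Phi s) ->
           forall Phi, SMdual P M Phi -> K' Phi = K Phi)].
Proof.
have [[measM _] _ _ _ _] := hM; have [Z_L2M Z_orthonormal _] := hCRP.
have [f [f_inj f_surj]] := fset_nat_enumeration.
have [A hA] := spectral_le w hw.
exists (diag_op P M f (fun n => spectral w (f n))).
have cK : cont_lin_op P M (diag_op P M f (fun n => spectral w (f n))).
  exact: (diag_op_cont_lin _ _ measM Z_L2M Z_orthonormal _ f_inj f_surj _ A).
have fockK Phi : SMdual P M Phi -> forall s,
    fock M (diag_op P M f (fun n => spectral w (f n)) Phi) s =
    (spectral w s)%:C * fock M Phi s.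
  move=> dPhi s; have [n <-] := f_surj s.
  exact: (diag_op_fock _ _ measM Z_L2M Z_orthonormal _ f_inj f_surj _ A).
split=> // K' [K'dual _ _] fockK' Phi dPhi.
(* Both images lie in S*(M), where equal Fock transforms force equality. *)
apply: (SMdual_fock_inj _ _ _ P M) => //; [exact: K'dual|by case: cK => + _ _; apply|].
by move=> s; rewrite fockK'// fockK.
Qed.
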